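(* Let $k\ge 1$ be a fixed integer and let $p=n^{\alpha}$ with $\alpha<-1/k$ a constant. Then almost always $\widetilde{H}_k(X(n,p),\mathbb{Z})=0$.
   Context: $G(n,p)$ is the random graph on vertex set $[n]$ with each edge included independently with probability $p$. The clique complex $X(H)$ of a graph $H$ is the simplicial complex whose faces are the vertex sets of complete subgraphs of $H$; $X(n,p)$ denotes $X(G(n,p))$. $\widetilde H_k$ denotes reduced homology. ''Almost always'' means with probability tending to $1$ as $n\to\infty$. *)

(* Defs.v *)
From HB Require Import structures.
From mathcomp Require Import all_boot all_order all_algebra.
From mathcomp Require Import all_classical all_reals all_analysis.
Import Order.TTheory GRing.Theory Num.Theory.
Import numFieldNormedType.Exports.

Set Implicit Arguments.
Unset Strict Implicit.
Unset Printing Implicit Defensive.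

Local Open Scope ring_scope.

(* The empty face is part of the structure: it generates the chain group in   *)
(* dimension -1, which is what makes the homology below reduced.              *)
Record simplicial_complex (n : nat) := SimplicialComplex {
  faces :> {set {set 'I_n}};
  faces0 : finset.set0 \in faces;
  faces_sub : forall s t : {set 'I_n}, t \subset s -> s \in faces -> t \in faces
}.

Section Homology.
Variables (n : nat) (K : simplicial_complex n).

(* Faces are indexed by their number m of vertices, i.e. by dimension + 1.    *)
Definition face (m : nat) := {s : {set 'I_n} | (s \in faces K) && (#|s| == m)}.

Definition chain (m : nat) := {ffun face m -> int}.

Definition sign (s : {set 'I_n}) (v : 'I_n) : int :=
  (-1) ^+ #|[set u in s | (u < v)%N]|.

(* The coefficient of t in the boundary of s = {v_0 < ... < v_d}, which is    *)
(* the sum over i of (-1)^i (s \ v_i).                                        *)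
Definition incidence (s t : {set 'I_n}) : int :=
  \sum_(v in s | t == s :\ v) sign s v.

Definition boundary (m : nat) (c : chain m.+1) : chain m :=
  [ffun t => \sum_(s : face m.+1) incidence (val s) (val t) * c s].

Lemma boundary_zmod_morphism m : zmod_morphism (@boundary m).
Proof.
move=> c d; apply/ffunP => t; rewrite !ffunE -sumrB.
by apply: eq_bigr => s _; rewrite !ffunE mulrBr.
Qed.

HB.instance Definition _ m :=
  GRing.isZmodMorphism.Build (chain m.+1) (chain m) (@boundary m)
    (@boundary_zmod_morphism m).

Lemma sign_setD1 (r : {set 'I_n}) (v w : 'I_n) : v \in r ->
  sign (r :\ v) w = (-1) ^+ (v < w)%N * sign r w.
Proof.
move=> vr; rewrite /sign (cardsD1 v [set u in r | (u < w)%N]) inE vr /=.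
rewrite exprD mulrA -expr2 sqrr_sign mul1r; congr (_ ^+ #|pred_of_set _|).
by apply/setP => u; rewrite !inE andbA.
Qed.

Lemma sum_sign_setD1 (r t : {set 'I_n}) :
  \sum_(v in r) \sum_(w in r :\ v | t == r :\ v :\ w)
    sign (r :\ v) w * sign r v = 0.
Proof.
set S := LHS; suff SN : S = - S.
  by have := mulrn_eq0 S 2; rewrite mulr2n {1}SN addNr eqxx => /esym/eqP.
rewrite {1}/S (exchange_big_dep (mem r)) /=; last first.
  by move=> v w _ /andP[]; rewrite !inE => /andP[_ ->].
rewrite /S -sumrN; apply: eq_bigr => v vr; rewrite -sumrN.
apply: eq_big => [w|w].
  rewrite !inE vr andbT eq_sym.
  have -> : r :\ w :\ v = r :\ v :\ w by rewrite !finset.setDDl finset.setUC.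
  by rewrite andbA (andbC (w \in r)).
move=> /andP[wr /andP[]]; rewrite inE => /andP[]; rewrite inE => vw _ _.
rewrite !sign_setD1 // -!mulrA (mulrC (sign r w)) -mulNr; congr (_ * _).
by case: (ltngtP v w) vw => // /val_inj ->; rewrite eqxx.
Qed.

Lemma boundaryK m (c : chain m.+2) : boundary (boundary c) = 0.
Proof.
apply/ffunP => t; rewrite !ffunE.
under eq_bigr => s _ do rewrite ffunE mulr_sumr.
rewrite exchange_big /= big1 // => r _.
under eq_bigr => s _ do rewrite mulrA.
rewrite -mulr_suml; apply/eqP; rewrite mulf_eq0; apply/orP; left; apply/eqP.
rewrite -[RHS](sum_sign_setD1 (val r) (val t)).
under eq_bigr => s _ do rewrite /incidence mulr_sumr big_mkcondr.
rewrite exchange_big; apply: eq_bigr => v vr /=.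
have [rK cr] := andP (valP r).
have rvP : (val r :\ v \in faces K) && (#|val r :\ v| == m.+1).
  rewrite (faces_sub _ rK) ?subD1set //=.
  by move: cr; rewrite (cardsD1 v) vr.
rewrite (bigD1 (Sub (val r :\ v) rvP : face m.+1)) //= eqxx.
rewrite [X in _ + X]big1 ?addr0 ?mulr_suml // => s sr.
by case: eqP => // svr; case/eqP: sr; apply: val_inj.
Qed.

(* From here on, k is the dimension.                                          *)
Definition cycle_pred (k : nat) (c : chain k.+1) : bool :=
  boundary c == 0.

Lemma cycle_pred_zmod_closed k : zmod_closed (@cycle_pred k).
Proof.
split=> [|c d]; rewrite !unfold_in /cycle_pred ?raddf0 //.
by move=> /eqP bc /eqP bd; rewrite raddfB /= bc bd subrr.
Qed.

HB.instance Definition _ k :=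
  GRing.isZmodClosed.Build (chain k.+1) (@cycle_pred k) (@cycle_pred_zmod_closed k).

Definition cycle_group (k : nat) := {c : chain k.+1 | @cycle_pred k c}.

HB.instance Definition _ k := Choice.on (cycle_group k).
HB.instance Definition _ k := SubType.on (cycle_group k).
HB.instance Definition _ k := [SubChoice_isSubZmodule of cycle_group k by <:].

Definition boundary_pred (k : nat) (z : cycle_group k) : bool :=
  `[< exists b : chain k.+2, val z = boundary b >].

Lemma boundary_pred_zmod_closed k : zmod_closed (@boundary_pred k).
Proof.
split=> [|y z]; rewrite !unfold_in.
  by apply/asboolP; exists 0; rewrite !raddf0.
move=> /asboolP[b yb] /asboolP[c zc]; apply/asboolP; exists (b - c).
by rewrite [RHS]raddfB /= -yb -zc.
Qed.

HB.instance Definition _ k :=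
  GRing.isZmodClosed.Build (cycle_group k) (@boundary_pred k) (@boundary_pred_zmod_closed k).

Definition reduced_homology (k : nat) : zmodType :=
  Quotient.quot (GRing.ZmodClosed.clone _ (@boundary_pred k) _).

End Homology.

Definition edge (n : nat) := {e : {set 'I_n} | #|e| == 2}.

Definition graph (n : nat) := {set edge n}.

Definition adj (n : nat) (G : graph n) (u v : 'I_n) : bool :=
  [exists e in G, val e == [set u; v]].

Section CliqueComplex.
Variables (n : nat) (G : graph n).

Definition cliques : {set {set 'I_n}} :=
  [set s : {set 'I_n} | [forall u in s, forall v in s, (u != v) ==> adj G u v]].

Lemma cliques0 : finset.set0 \in cliques.
Proof. by rewrite inE; apply/forall_inP => u; rewrite inE. Qed.

Lemma cliques_sub (s t : {set 'I_n}) :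
  t \subset s -> s \in cliques -> t \in cliques.
Proof.
move=> /fintype.subsetP ts; rewrite !inE => /forall_inP sG.
apply/forall_inP => u /ts us; apply/forall_inP => v /ts vs.
by move/forall_inP: (sG u us); apply.
Qed.

Definition clique_complex : simplicial_complex n :=
  SimplicialComplex cliques0 cliques_sub.

End CliqueComplex.

Definition Gnp_weight (R : realType) (n : nat) (p : R) (G : graph n) : R :=
  \prod_(e : edge n) (if e \in G then p else 1 - p).

Definition Gnp_prob (R : realType) (n : nat) (p : R) (A : graph n -> Prop) : R :=
  \sum_(G : graph n | `[< A G >]) Gnp_weight p G.

Definition almost_always (R : realType) (p : nat -> R)
    (A : forall n, graph n -> Prop) : Prop :=
  ((fun n => Gnp_prob (p n) (@A n)) @ \oo --> (1 : R))%classic.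

(* Main.v *)
Require Import Defs.
From mathcomp Require Import all_boot all_order all_algebra.
From mathcomp Require Import zify ring.
Import Order.TTheory GRing.Theory Num.Theory.

(** A cycle of a clique complex is a boundary as soon as, for some vertex [v],
    its link at [v] bounds in the link of [v] and cycles avoiding [v] bound
    (write [z = v * y + z'] and fill [y]). Induction gives first that clique
    complexes on fewer than [2 m] vertices have no homology of [m]-vertex
    chains (so none in dimension [m - 1]), and then that a graph all of whose
    nonempty subgraphs have a vertex of degree less than [2 k] has no homology
    in dimension [k].

    Starting from a [k]-face, keep adding vertices that have at least [k]
    neighbours in the current set. Either the set reaches a fixed size [N],
    with at least [k (N - k - 1)] edges, or the process stops at a set [U] with
    fewer than [N] vertices. In the latter case the part of a cycle inside [U]
    is itself a cycle, and it bounds unless some nonempty subset [T] of [U]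
    spans at least [k |T|] edges. Since [1 + k alpha < 0], for [N] large enough
    the expected number of such dense sets of at most [N] vertices tends to 0. *)

Set Implicit Arguments.
Unset Strict Implicit.
Unset Printing Implicit Defensive.

Local Open Scope ring_scope.

(** * Boundary and cone operators on integer chains *)

Section SetChains.
Variable n : nat.
Implicit Types (f g w z : {set 'I_n} -> int) (s t : {set 'I_n}) (v : 'I_n).

(* Chains are functions on all vertex sets, so that chains of every dimension *)
(* and of every subcomplex share one type; [carried] bounds their support.    *)
Definition bd f t : int := \sum_(v | v \notin t) sign t v * f (v |: t).

Definition cone v f s : int := if v \in s then sign s v * f (s :\ v) else 0.

Lemma signK s v : sign s v * sign s v = 1.
Proof. by rewrite /sign -expr2 sqrr_sign. Qed.

Lemma sign_setU1 s v u : v \notin s ->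
  sign (v |: s) u = (-1) ^+ (v < u)%N * sign s u.
Proof.
move=> vs; rewrite -{2}(setU1K vs) sign_setD1 ?setU11 //.
by rewrite mulrA -expr2 sqrr_sign mul1r.
Qed.

Lemma sign_setU1_id s v : sign (v |: s) v = sign s v.
Proof.
case: (boolP (v \in s)) => [vs|/sign_setU1 ->]; last by rewrite ltnn mul1r.
by rewrite (setUidPr _) ?sub1set.
Qed.

Lemma eq_bd f g : f =1 g -> bd f =1 bd g.
Proof. by move=> fg t; apply: eq_bigr => v _; rewrite fg. Qed.

Lemma bdD f g t : bd (fun s => f s + g s) t = bd f t + bd g t.
Proof. by rewrite -big_split; apply: eq_bigr => v _; rewrite mulrDr. Qed.

Lemma bdN f t : bd (fun s => - f s) t = - bd f t.
Proof. by rewrite /bd -sumrN; apply: eq_bigr => v _; rewrite mulrN. Qed.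

(** At [t] without [v] only the vertex [v] contributes, giving [w t]. At [t] containing [v],
    exchanging the order in which [u] and [v] are inserted flips exactly one sign. *)
Lemma bd_cone v w : (forall s, v \in s -> w s = 0) ->
  forall t, bd (cone v w) t = w t - cone v (bd w) t.
Proof.
move=> wv t; rewrite /cone; case: (boolP (v \in t)) => vt; last first.
  rewrite subr0 /bd (bigD1 v) //= setU11 sign_setU1_id mulrA signK mul1r setU1K //.
  rewrite big1 ?addr0 // => u /andP[ut uv].
  by rewrite !inE eq_sym (negPf uv) (negPf vt) mulr0.
rewrite (wv _ vt) sub0r -{1}(setD1K vt); set r := t :\ v.
have vr : v \notin r by rewrite !inE eqxx.
rewrite /bd mulr_sumr -sumrN [in RHS](bigD1 v) //= (wv (v |: r)) ?setU11 //.
rewrite !mulr0 oppr0 add0r; apply: eq_big => [u|u].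
  by rewrite !inE negb_or negb_and negbK andbC; case: eqVneq.
rewrite !inE negb_or => /andP[uv].
rewrite uv /= => ut; have ur : u \notin r by rewrite !inE negb_and ut orbT.
rewrite eqxx orbT setUCA setU1K; last by rewrite !inE eq_sym (negPf uv) eqxx.
rewrite -(setD1K vt) -/r sign_setU1 // !sign_setU1_id sign_setU1 //.
rewrite !mulrA -mulNr; congr (_ * _).
have : (u != v :> nat) by [].
by case: ltngtP => // _ _; rewrite ?expr0 ?expr1 /=; ring.
Qed.

(** [base] and [slice] are the parts [z'] and [y] of the decomposition [z = v * y + z']. *)
Definition base v z s : int := if v \in s then 0 else z s.

Definition slice v z s : int := if v \in s then 0 else sign s v * z (v |: s).

Lemma cone_slice_base v z s : z s = cone v (slice v z) s + base v z s.
Proof.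
rewrite /cone /slice /base; case: ifP => [vs|]; last by rewrite add0r.
by rewrite setD11 addr0 mulrA -(sign_setU1_id (s :\ v)) setD1K // signK mul1r.
Qed.

Lemma bd_base v z : (forall t, bd z t = 0) -> forall t, bd (base v z) t = - slice v z t.
Proof.
move=> zc t; have := zc t.
rewrite (eq_bd (cone_slice_base v z)) bdD bd_cone; last by move=> s; rewrite /slice => ->.
rewrite /cone; case: ifP => [vt _|_ /eqP]; last by rewrite subr0 addrC addr_eq0 => /eqP.
rewrite /slice vt oppr0 /bd big1 // => u _.
by rewrite /base !inE vt orbT mulr0.
Qed.

Lemma bd_slice v z : (forall t, bd z t = 0) -> forall t, bd (slice v z) t = 0.
Proof.
move=> zc t; case: (boolP (v \in t)) => vt.
  by rewrite /bd big1 // => u _; rewrite /slice !inE vt orbT mulr0.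
(* At [v |: t] the slice vanishes, so only the cone over [bd (slice v z)] survives, with a unit
   coefficient. *)
have := zc (v |: t); rewrite (eq_bd (cone_slice_base v z)) bdD bd_base //.
rewrite bd_cone; last by move=> s; rewrite /slice => ->.
rewrite {1 3}/slice setU11 subr0 sub0r /cone setU11 setU1K // => /eqP.
by rewrite oppr_eq0 mulf_eq0 /sign signr_eq0 => /eqP.
Qed.

End SetChains.

(** * Fillings in clique complexes *)

Section Cliques.
Variables (n : nat) (G : graph n).
Implicit Types (S T U s t : {set 'I_n}) (z w b : {set 'I_n} -> int) (u v : 'I_n).

Definition link S v : {set 'I_n} := [set u in S | adj G v u].

Lemma adjC u v : adj G u v = adj G v u.
Proof. by rewrite /adj; under eq_existsb do rewrite setUC. Qed.

Lemma adjvv v : adj G v v = false.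
Proof.
apply/existsP => -[e /andP[_ /eqP ev]]; have := valP e.
by rewrite /= ev setUid cards1.
Qed.

Lemma cliqueP s :
  reflect {in s &, forall u v, u != v -> adj G u v} (s \in cliques G).
Proof.
rewrite inE; apply: (iffP forall_inP) => [h u v us vs|h u us].
  by move/forall_inP: (h u us) => /(_ v vs) /implyP.
by apply/forall_inP => v vs; apply/implyP; apply: h.
Qed.

Lemma clique_setU1 v s : v \notin s ->
  (v |: s \in cliques G) = (s \in cliques G) && (s \subset link [set: 'I_n] v).
Proof.
move=> vs; apply/cliqueP/andP => [h|[/cliqueP h /subsetP l] x y].
  split; first by apply/cliqueP => x y xs ys; apply: h; rewrite !inE ?xs ?ys orbT.
  apply/subsetP => x xs; rewrite !inE h ?setU11 ?inE ?xs ?orbT //.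
  by apply: contraNneq vs => ->.
rewrite !inE => /orP[/eqP->|xs] /orP[/eqP->|ys]; rewrite ?eqxx //.
- by move=> _; have := l _ ys; rewrite inE => /andP[].
- by move=> _; have := l _ xs; rewrite adjC inE => /andP[].
- exact: h.
Qed.

Lemma link_sub S v : link S v \subset S :\ v.
Proof.
apply/subsetP => u; rewrite !inE => /andP[-> a]; rewrite andbT.
by apply: contraTneq a => ->; rewrite adjvv.
Qed.

Definition carried S m z :=
  forall s, z s != 0 -> [/\ s \in cliques G, s \subset S & #|s| = m].

Lemma carriedW S T m z : S \subset T -> carried S m z -> carried T m z.
Proof. by move=> ST zS s /zS[? sS ?]; split=> //; apply: subset_trans ST. Qed.

Lemma carriedD S m z w : carried S m z -> carried S m w ->
  carried S m (fun s => z s + w s).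
Proof.
by move=> zS wS s; case: (eqVneq (z s) 0) => [->|/zS//]; rewrite add0r => /wS.
Qed.

Lemma carriedN S m z : carried S m z -> carried S m (fun s => - z s).
Proof. by move=> zS s; rewrite oppr_eq0 => /zS. Qed.

Lemma carried_base S m v z : carried S m z -> carried (S :\ v) m (base v z).
Proof.
move=> zS s; rewrite /base; case: ifP; rewrite ?eqxx // => vs /zS[? ? ?].
by split=> //; rewrite subsetD1 vs andbT.
Qed.

Lemma carried_slice S m v z : carried S m.+1 z -> carried (link S v) m (slice v z).
Proof.
move=> zS s; rewrite /slice; case: (boolP (v \in s)); rewrite ?eqxx // => vs.
rewrite mulf_eq0 negb_or => /andP[_ /zS[]]; rewrite clique_setU1 // => /andP[sc sl].
rewrite cardsU1 vs => sS [sm]; split=> //.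
apply/subsetP => x xs; rewrite inE (subsetP sS) ?inE ?xs ?orbT //.
by have := subsetP sl _ xs; rewrite inE => /andP[].
Qed.

Lemma carried_cone S m v w : v \in S -> carried (link S v) m w ->
  carried S m.+1 (cone v w).
Proof.
move=> vS wl s; rewrite /cone; case: ifP; rewrite ?eqxx // => vs.
rewrite mulf_eq0 negb_or => /andP[_ /wl[sc sl sm]].
have sS : s :\ v \subset S.
  by apply: subset_trans sl _; apply/subsetP => x; rewrite inE => /andP[].
split; last by rewrite (cardsD1 v) vs sm.
- rewrite -(setD1K vs) clique_setU1 ?setD11 // sc.
  apply: subset_trans sl _; apply/subsetP => x.
  by rewrite !inE => /andP[].
- by rewrite -(setD1K vs) subUset sub1set vS.
Qed.

(** Here [m] counts vertices: this is vanishing reduced homology in dimension [m - 1] of the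
    subcomplex induced on [S]. *)
Definition acyclic S m := forall z, carried S m z -> (forall t, bd z t = 0) ->
  exists2 b, carried S m.+1 b & z =1 bd b.

Lemma acyclic_cone S m v : v \in S -> S :\ v \subset link S v -> acyclic S m.+1.
Proof.
move=> vS Sl z zS zc; exists (cone v (base v z)).
  by apply: carried_cone => //; apply: carriedW Sl _; apply: carried_base.
move=> s; rewrite bd_cone; last by move=> t; rewrite /base => ->.
rewrite [LHS](cone_slice_base v) addrC /cone; case: ifP => // _.
by rewrite bd_base // mulrN opprK.
Qed.

(** A Mayer-Vietoris argument made explicit: if [w] fills the slice in the link, then [base v z + w]
    is a cycle avoiding [v]; a filling [b] of it gives the filling [b - cone v w] of [z]. *)
Lemma acyclic_del S m v : v \in S -> acyclic (link S v) m -> acyclic (S :\ v) m.+1 ->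
  acyclic S m.+1.
Proof.
move=> vS la da z zS zc.
have [w wl yw] := la _ (carried_slice (v := v) zS) (@bd_slice _ v z zc).
have wS := carriedW (link_sub S v) wl.
have wv s : v \in s -> w s = 0.
  move=> vs; apply: contraTeq vs => /wS[_]; by rewrite subsetD1 => /andP[].
have [b bS eb] : exists2 b, carried (S :\ v) m.+2 b &
    (fun s => base v z s + w s) =1 bd b.
  apply: da => [|t]; first by apply: carriedD => //; apply: carried_base.
  by rewrite bdD bd_base // -yw addNr.
exists (fun s => b s - cone v w s).
  apply: carriedD; first exact: carriedW (subsetDl _ _) bS.
  by apply: carriedN; apply: carried_cone.
move=> s; rewrite bdD bdN bd_cone // -eb [LHS](cone_slice_base v).
rewrite /cone yw; ring.
Qed.

Lemma acyclic_set0 m : acyclic set0 m.+1.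
Proof.
move=> z z0 _; exists (fun=> 0) => [s|s]; first by rewrite eqxx.
rewrite /bd big1 => [|u _]; last by rewrite mulr0.
by apply/eqP/negPn/negP => /z0[_]; rewrite subset0 => /eqP->; rewrite cards0.
Qed.

(** Either [v] is adjacent to all other vertices and [S] is a cone, or the link of [v] misses [v]
    and one more vertex, so its size drops by two as [m] drops by one. Cross-polytopes show that the
    bound is sharp. *)
Lemma acyclic_lt_double m S : (#|S| < 2 * m)%N -> acyclic S m.
Proof.
elim: m S => [S|m IHm S]; first by rewrite muln0.
have [c] := ubnP #|S|; elim: c S => // c IHc S Sc Sm.
have [->|[v vS]] := set_0Vmem S; first exact: acyclic_set0.
have := cardsD1 v S; rewrite vS add1n => cS.
case: (boolP (S :\ v \subset link S v)) => [|h]; first exact: acyclic_cone.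
have lt : (#|link S v| < #|S :\ v|)%N by rewrite proper_card // /proper link_sub.
apply: (acyclic_del vS); [apply: IHm | apply: IHc];
  move: Sc Sm cS lt; move: #|S| #|S :\ v| #|link S v| => a b d; lia.
Qed.

Lemma acyclic_degenerate k S :
  (forall T, T \subset S -> T != set0 -> exists2 v, v \in T & (#|link T v| < 2 * k)%N) ->
  acyclic S k.+1.
Proof.
have [c] := ubnP #|S|; elim: c S => // c IHc S Sc h.
have [->|S0] := eqVneq S set0; first exact: acyclic_set0.
have [v vS lv] := h S (subxx _) S0.
apply: (acyclic_del vS); first exact: acyclic_lt_double.
apply: IHc => [|T TS]; first by move: Sc; rewrite (cardsD1 v S) vS.
by apply: h; apply: subset_trans TS (subsetDl _ _).
Qed.

(* Cutting a cycle down to a vertex set [U] that no outside vertex joins by   *)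
(* [k] edges leaves a cycle, as a [k]-face crossing out of [U] meets it in    *)
(* fewer than [k] vertices.                                                   *)
Lemma acyclic_local k :
  (forall s, s \in cliques G -> #|s| = k.+1 ->
    exists U, [/\ s \subset U, acyclic U k.+1 &
      forall v, v \notin U -> (#|link U v| < k)%N]) ->
  acyclic [set: 'I_n] k.+1.
Proof.
move=> loc z; have [c] := ubnP #|[set s | z s != 0]|.
elim: c z => // c IHc z zc zS z0.
have [h|[s]] := set_0Vmem [set s | z s != 0].
  exists (fun=> 0) => [s|s]; first by rewrite eqxx.
  rewrite /bd big1 => [|u _]; last by rewrite mulr0.
  by move/setP: h => /(_ s); rewrite !inE => /negbFE/eqP.
rewrite inE => zs; have [sc _ sk] := zS s zs.
have [U [sU Ua Ul]] := loc s sc sk.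
pose zU s := if s \subset U then z s else 0.
have zUc : carried U k.+1 zU.
  by move=> t; rewrite /zU; case: ifP; rewrite ?eqxx // => ? /zS[].
have zU0 t : bd zU t = 0.
  case: (boolP (t \subset U)) => tU; last first.
    rewrite /bd big1 // => u _; rewrite /zU subUset (negPf tU) andbF.
    by rewrite mulr0.
  rewrite -[RHS](z0 t); apply: eq_bigr => v vt; congr (_ * _).
  rewrite /zU subUset tU sub1set andbT; case: ifP => // /negbT vU.
  apply/esym/eqP/negPn/negP => /zS[]; rewrite clique_setU1 // => /andP[_ tl] _.
  rewrite cardsU1 vt => -[tk]; have := Ul _ vU; rewrite -tk ltnNge subset_leq_card //.
  apply/subsetP => x xt; rewrite inE (subsetP tU) //.
  by have := subsetP tl _ xt; rewrite inE => /andP[].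
have [b bU eb] := Ua _ zUc zU0.
(* Induction on the size of the support: subtracting [zU] adds no face and removes [s]. *)
have [|||d dS ed] := IHc (fun s => z s - zU s).
- rewrite -ltnS (leq_trans _ zc) // ltnS proper_card //; apply/properP; split.
    apply/subsetP => t; rewrite !inE /zU; case: ifP; rewrite ?subr0 //.
    by rewrite subrr eqxx.
  by exists s; rewrite !inE // /zU sU subrr eqxx.
- by apply: carriedD => //; apply: carriedN; apply: carriedW zUc.
- by move=> t; rewrite bdD bdN z0 zU0 subr0.
exists (fun s => d s + b s).
  by apply: carriedD => //; apply: carriedW bU.
by move=> t; rewrite bdD -ed -eb subrK.
Qed.

End Cliques.

(** * Edge counts and sparse graphs *)

Section Edges.
Variables (n : nat) (G : graph n).
Implicit Types (S T U s : {set 'I_n}) (v : 'I_n) (e : edge n).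

Definition edges_in S : {set edge n} := [set e in G | val e \subset S].

Lemma card_link S v : v \in S ->
  (#|link G S v| <= #|[set e in edges_in S | v \in val e]|)%N.
Proof.
move=> vS; rewrite -(card_in_imset (f := fun u => [set v; u])) => [|x y]; last first.
  move=> /(subsetP (link_sub G S v)); rewrite !inE => /andP[xv _] _.
  by move=> /setP/(_ x); rewrite !inE eqxx orbT (negPf xv) => /esym/eqP.
rewrite -[leqRHS](card_imset _ val_inj); apply/subset_leq_card/subsetP.
move=> _ /imsetP[u + ->].
rewrite inE => /andP[uS /existsP[e /andP[eG /eqP ev]]].
apply/imsetP; exists e => //; rewrite !inE eG ev !inE eqxx /=.
by rewrite subUset !sub1set vS uS.
Qed.

(** Double counting of incidences: each edge inside [S] has two endpoints in [S]. *)
Lemma edges_in_double S k :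
  (forall v, v \in S -> (2 * k <= #|link G S v|)%N) -> (k * #|S| <= #|edges_in S|)%N.
Proof.
move=> h; rewrite -(leq_pmul2l (isT : 0 < 2)%N) mulnA [leqRHS]mulnC.
have -> : (#|edges_in S| * 2 = \sum_(e in edges_in S) \sum_(v in S) (v \in val e))%N.
  rewrite -sum_nat_const; apply: eq_bigr => e; rewrite inE => /andP[_ eS].
  rewrite -big_mkcondr /= sum1_card; apply: etrans (esym (eqP (valP e))) _.
  apply: eq_card => v; rewrite [RHS]unfold_in /=.
  case: (boolP (v \in val e)); rewrite ?andbF //.
  by move=> /(subsetP eS) ->.
rewrite exchange_big /= mulnC -sum_nat_const; apply: leq_sum => v vS.
apply: leq_trans (h v vS) _; apply: leq_trans (card_link vS) _.
rewrite -big_mkcondr /= sum1_card; apply/eq_leq/eq_card => e.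
by rewrite [RHS]unfold_in inE.
Qed.

Lemma edges_in_setU1 S v : v \notin S ->
  (#|edges_in S| + #|link G S v| <= #|edges_in (v |: S)|)%N.
Proof.
move=> vS; have -> : link G S v = link G (v |: S) v.
  by apply/setP => u; rewrite !inE; case: eqVneq => // ->; rewrite adjvv andbF.
apply: leq_trans (leq_add (leqnn _) (card_link (setU11 v S))) _.
rewrite -(cardsID [set e : edge n | v \in val e] (edges_in (v |: S))) addnC.
apply: leq_add; apply/subset_leq_card/subsetP => e; rewrite !inE //.
move=> /andP[-> eS]; apply/and3P; split=> //.
  by apply: contra vS => /(subsetP eS).
exact: subset_trans eS (subsetUr _ _).
Qed.

(* A maximal vertex set containing a given face, with at most [N] vertices    *)
(* and at least [k (|U| - k - 1)] edges, has fewer than [N] vertices, so no   *)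
(* vertex outside it has [k] neighbours in it.                                *)
Lemma acyclic_sparse k N : (k < N)%N ->
  (forall S, S != set0 -> (#|S| < N)%N -> (#|edges_in S| < k * #|S|)%N) ->
  (forall S, #|S| = N -> (#|edges_in S| + k * k.+1 < k * N)%N) ->
  acyclic G [set: 'I_n] k.+1.
Proof.
move=> kN small big; apply: acyclic_local => s sc sk.
(* The slack [k * k.+1] makes the start [s] admissible whatever its edges; a new vertex with [k]
   neighbours raises both sides by at least the required [k]. *)
pose P U := [&& s \subset U, (#|U| <= N)%N & (k * #|U| <= #|edges_in U| + k * k.+1)%N].
have Ps : P s by rewrite /P subxx sk kN leq_addl.
have [U /maxsetP[/and3P[sU UN Ue] Umax] _] := maxset_exists Ps.
have {}UN : (#|U| < N)%N.
  rewrite ltn_neqAle UN andbT; apply/eqP => cU.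
  by have := big _ cU; rewrite ltnNge -cU Ue.
exists U; split=> //.
  apply: acyclic_degenerate => T TU T0.
  have TN : (#|T| < N)%N by apply: leq_ltn_trans (subset_leq_card TU) UN.
  have [/exists_inP[v vT lv]|] := boolP [exists v in T, #|link G T v| < 2 * k]%N.
    by exists v.
  move=> /exists_inPn h; have := small T T0 TN; rewrite ltnNge edges_in_double // => v vT.
  by rewrite leqNgt h.
move=> v vU; rewrite ltnNge; apply/negP => kl.
suff /Umax e : P (v |: U) by move: vU; rewrite -(e (subsetUr _ _)) setU11.
rewrite /P (subset_trans sU (subsetUr _ _)) cardsU1 vU UN /=.
rewrite add1n mulnS; apply: leq_trans (leq_add kl Ue) _.
by rewrite addnA leq_add2r addnC edges_in_setU1.
Qed.

End Edges.

From mathcomp Require Import all_classical all_reals all_analysis.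
Import numFieldNormedType.Exports.

(** * From set chains back to the homology groups *)

Section Transfer.
Variables (n : nat) (K : simplicial_complex n).

Definition extend m (c : chain K m) (s : {set 'I_n}) : int :=
  oapp c 0 (insub s).

Lemma extend_val m (c : chain K m) (s : face K m) : extend c (val s) = c s.
Proof. by rewrite /extend valK. Qed.

Lemma extend_support m (c : chain K m) (s : {set 'I_n}) :
  extend c s != 0 -> (s \in faces K) && (#|s| == m).
Proof. by rewrite /extend; case: insubP => //=; rewrite eqxx. Qed.

(** Both sums run over the ways to write [s = v |: t] with [v] outside [t]; sets that are not faces
    contribute zero by the extension. *)
Lemma boundaryE m (c : chain K m.+1) (t : face K m) :
  boundary c t = bd (extend c) (val t).
Proof.
rewrite ffunE /bd; move: (val t) => {}t.
under eq_bigr => s _ do rewrite /incidence mulr_suml big_mkcond.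
rewrite exchange_big /= [in RHS]big_mkcond; apply: eq_bigr => v _ /=.
have vts (s : {set 'I_n}) : (v \in s) && (t == s :\ v) = (v \notin t) && (s == v |: t).
  apply/andP/andP => -[h /eqP ->]; rewrite ?finset.setD1K // ?finset.setU1K // ?setD11 //.
  by rewrite finset.setU11.
under eq_bigr => s _ do rewrite vts.
case: ifP => vt; last by rewrite big1.
have [/extend_support h|/negPn/eqP z0] := boolP (extend c (v |: t) != 0).
  pose s : face K m.+1 := Sub (v |: t) h.
  rewrite -big_mkcond (big_pred1 s) => [|s'].
    by rewrite -(extend_val c s) sign_setU1_id.
  by rewrite -[RHS]val_eqE.
rewrite big1 => [|s _].
  by rewrite -(mulr0 (sign t v)); congr (_ * _); rewrite -z0.
case: ifP => // /eqP e.
have -> : c s = 0 by rewrite -(extend_val c s); apply: etrans (congr1 (extend c) e) z0.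
exact: mulr0.
Qed.
Lemma homology_eq0 k :
  (forall c : chain K k.+1, boundary c = 0 -> exists b : chain K k.+2, c = boundary b) ->
  forall x : reduced_homology K k, x = 0.
Proof.
move=> h x; rewrite -[x]reprK.
have [b eb] : exists b, val (repr x) = boundary b by apply: h; apply/eqP/(valP (repr x)).
have : repr x - 0 \in GRing.ZmodClosed.clone _ (@boundary_pred n K k) _.
  by rewrite subr0 unfold_in; apply/asboolP; exists b.
rewrite Quotient.idealrBE => /eqP ->.
exact: (esym (equal_toE (Quotient.pi_zero_morph _))).
Qed.

End Transfer.

Lemma homology_clique_eq0 n (G : graph n) k : acyclic G [set: 'I_n] k.+1 ->
  forall x : reduced_homology (clique_complex G) k, x = 0.
Proof.
move=> a; apply: homology_eq0 => c c0.
have [||f fc ef] := a (extend c).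
- by move=> s /extend_support/andP[sG /eqP sk]; rewrite finset.subsetT.
- move=> t; have [h|h] := boolP ((t \in faces (clique_complex G)) && (#|t| == k)).
    by rewrite -[t]/(val (Sub t h : face (clique_complex G) k)) -boundaryE c0 ffunE.
  rewrite /bd big1 // => v vt.
  have [|/negPn/eqP->] := boolP (extend c (v |: t) != 0); last exact: mulr0.
  move=> /extend_support/andP[vtG]; rewrite cardsU1 vt add1n eqSS => tk.
  by case/negP: h; rewrite tk andbT (faces_sub _ vtG) ?finset.subsetUr.
(* Restricting [f] to faces loses nothing, since it is carried by cliques with [k.+2] vertices. *)
exists [ffun s => f (val s)]; apply/ffunP => s.
rewrite -(extend_val c s) ef boundaryE; apply: eq_bigr => v _; congr (_ * _).
have [h|h] := boolP (f (v |: val s) != 0).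
  have [vG _ vk] := fc _ h.
  have vP : (v |: val s \in faces (clique_complex G)) && (#|v |: val s| == k.+2).
    by rewrite vG vk eqxx.
  rewrite -[v |: val s]/(val (Sub (v |: val s) vP : face (clique_complex G) k.+2)).
  by rewrite extend_val ffunE.
rewrite (eqP (negPn h)) /extend; case: insubP => //= s' _ es.
by rewrite ffunE es; apply/esym/eqP/negPn.
Qed.


(** * First moment bound for dense vertex sets *)

Lemma bin_leq_expn n m : ('C(n, m) <= n ^ m)%N.
Proof.
apply: leq_trans (leq_pmulr _ (fact_gt0 m)) _; rewrite bin_ffact.
elim: m => // m IHm; rewrite ffactnSr expnSr; exact: leq_mul IHm (leq_subr _ _).
Qed.

Section FirstMoment.
Variables (R : realType) (n : nat) (p : R).
Hypotheses (p0 : 0 <= p) (p1 : p <= 1).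
Implicit Types (F G : {set edge n}) (S : {set 'I_n}).

Lemma Gnp_weight_ge0 G : 0 <= Gnp_weight p G.
Proof. by apply: prodr_ge0 => e _; case: ifP; rewrite ?subr_ge0. Qed.

Lemma sum_Gnp_weight_superset F :
  \sum_(G : {set edge n} | F \subset G) Gnp_weight p G = p ^+ #|F|.
Proof.
(* Expand a product over edges of present plus absent weights; absence has weight 0 on [F], which
   kills every [G] not containing [F]. *)
have := bigA_distr (zero := 0) 1 (mul := *%R) +%R (fun _ : edge n => p)
  (fun e => if e \in F then 0 else 1 - p).
rewrite (bigID (mem F)) /= [X in _ * X]big1 => [|e /negPf ->]; last by rewrite addrC subrK.
rewrite mulr1 (eq_bigr (fun=> p)) => [|e ->]; last by rewrite addr0.
rewrite prodr_const => ->; rewrite big_mkcond; apply: eq_bigr => G _.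
case: ifPn => [/fintype.subsetP FG|/subsetPn[e eF eG]].
  apply: eq_bigr => e _; case: ifPn => // eG; case: ifPn => // /FG eG'.
  by rewrite eG' in eG.
by rewrite (bigD1 e) //= (negPf eG) eF mul0r.
Qed.

Lemma sum_Gnp_weight : \sum_(G : {set edge n}) Gnp_weight p G = 1.
Proof.
have := sum_Gnp_weight_superset finset.set0; rewrite cards0 expr0 => <-.
by apply: eq_bigl => G; rewrite finset.sub0set.
Qed.

Lemma Gnp_probC (A : graph n -> Prop) :
  Gnp_prob p A + \sum_(G : {set edge n} | ~~ `[< A G >]) Gnp_weight p G = 1.
Proof. by rewrite -sum_Gnp_weight [RHS](bigID (fun G => `[< A G >])). Qed.

Lemma Gnp_prob_le1 (A : graph n -> Prop) : Gnp_prob p A <= 1.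
Proof.
rewrite -(Gnp_probC A) lerDl; apply: sumr_ge0 => G _; exact: Gnp_weight_ge0.
Qed.

Lemma Gnp_prob_mono (A B : graph n -> Prop) :
  (forall G, A G -> B G) -> Gnp_prob p A <= Gnp_prob p B.
Proof.
move=> AB; rewrite /Gnp_prob big_mkcond [leRHS]big_mkcond; apply: ler_sum => G _.
case: asboolP => [/AB BG|_]; case: asboolP => // _; exact: Gnp_weight_ge0.
Qed.

Lemma Gnp_prob_union_bound (I : finType) (P : pred I) (F : I -> {set edge n})
    (A : graph n -> Prop) :
  (forall G, ~ A G -> exists2 i, P i & F i \subset G) ->
  1 - \sum_(i | P i) p ^+ #|F i| <= Gnp_prob p A.
Proof.
move=> h; rewrite lerBlDr -(Gnp_probC A) lerD2l.
under [leRHS]eq_bigr => i _ do rewrite -sum_Gnp_weight_superset.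
rewrite (exchange_big_dep xpredT) //= [leRHS](bigID (fun G => `[< A G >])) /=.
rewrite -[leLHS]add0r lerD //.
  by apply: sumr_ge0 => G _; apply: sumr_ge0 => i _; apply: Gnp_weight_ge0.
apply: ler_sum => G /asboolPn /h[i Pi FG]; rewrite (bigD1 i) /= ?Pi //.
by rewrite lerDl; apply: sumr_ge0 => j _; apply: Gnp_weight_ge0.
Qed.

(** Union bound over pairs of a vertex set [S] of size [v] and a set of at least [m v] possible
    edges in [S]. There are at most [n ^ v] choices of [S] and, edges being subsets of [S], at most
    [2 ^ 2 ^ v] edge sets; this crude factor is constant in [n]. *)
Lemma Gnp_prob_no_dense (N : nat) (m : nat -> nat) :
  1 - \sum_(v < N.+1 | (0 < v)%N) (2 ^ 2 ^ v)%:R * (n%:R ^+ v * p ^+ m v) <=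
  Gnp_prob p (fun G : graph n => forall S : {set 'I_n},
    (0 < #|S| <= N)%N -> (#|edges_in G S| < m #|S|)%N).
Proof.
pose P (i : {set 'I_n} * {set edge n}) := [&& (0 < #|i.1| <= N)%N,
  i.2 \subset edges_in finset.setT i.1 & (m #|i.1| <= #|i.2|)%N].
apply: le_trans (Gnp_prob_union_bound (P := P) (F := snd) _); last first.
  move=> G /existsNP[S /not_implyP[S0 /negP]]; rewrite -leqNgt => mS.
  exists (S, edges_in G S).
    rewrite /P /= S0 mS andbT; apply/fintype.subsetP => e.
    by rewrite !inE => /andP[].
  by apply/fintype.subsetP => e; rewrite inE => /andP[].
rewrite lerD2l lerN2.
rewrite -(pair_big_dep (fun S : {set 'I_n} => (0 < #|S| <= N)%N)
  (fun S (F : {set edge n}) => (F \subset edges_in finset.setT S) && (m #|S| <= #|F|)%N)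
  (fun _ F => p ^+ #|F|)) /=.
rewrite (partition_big (fun S : {set 'I_n} => inord #|S| : 'I_N.+1)
  (fun v : 'I_N.+1 => (0 < v)%N)) /=; last first.
  by move=> S /andP[S0 SN]; rewrite inordK.
apply: ler_sum => v v0.
have cS (S : {set 'I_n}) : (0 < #|S| <= N)%N && (inord #|S| == v) = (#|S| == v).
  apply/andP/eqP => [[/andP[_ SN] /eqP <-]|Sv]; first by rewrite inordK.
  by rewrite Sv v0 -ltnS ltn_ord inord_val.
rewrite (eq_bigl _ _ cS).
apply: (@le_trans _ _ (\sum_(S : {set 'I_n} | #|S| == v) (2 ^ 2 ^ v)%:R * p ^+ m v)).
  apply: ler_sum => S /eqP Sv.
  apply: (@le_trans _ _ (\sum_(F : {set edge n} | F \subset edges_in finset.setT S) p ^+ m v)).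
    rewrite big_mkcondr /=; apply: ler_sum => F _; case: ifP => [|_]; last exact: exprn_ge0.
    by rewrite Sv; apply: ler_wiXn2l.
  under eq_bigl => F do rewrite -powersetE.
  rewrite sumr_const -[X in X <= _]mulr_natl ler_wpM2r ?exprn_ge0 // ler_nat.
  rewrite card_powerset leq_exp2l // -Sv -card_powerset.
  rewrite -(card_imset _ val_inj); apply/subset_leq_card/fintype.subsetP.
  move=> _ /imsetP[e + ->].
  by rewrite !inE.
rewrite sumr_const -[X in X <= _]mulr_natl mulrCA ler_wpM2l ?ler0n //.
rewrite ler_wpM2r ?exprn_ge0 // -natrX ler_nat; apply: leq_trans (bin_leq_expn n v).
by rewrite -[X in 'C(X, _)]card_ord -card_draws; apply/eq_leq/eq_card => S; rewrite inE.
Qed.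

End FirstMoment.

(** * Asymptotics and conclusion *)

Lemma powR_natr_cvg0 (R : realType) (b : R) : b < 0 ->
  ((fun n : nat => n%:R `^ b) @ \oo --> (0 : R))%classic.
Proof.
move=> b0; apply/cvgr0Pnorm_lt => e e0.
have nb0 : 0 < - b by rewrite oppr_gt0.
near=> n.
have n0 : 0 < n%:R :> R by rewrite ltr0n; near: n; exact: nbhs_infty_gt.
rewrite ger0_norm ?powR_ge0 // -[b]opprK powRN -[ltRHS]invrK.
rewrite ltf_pV2 ?posrE ?invr_gt0 ?powR_gt0 //.
have -> : e^-1 = ((e^-1) `^ (- b)^-1) `^ (- b).
  by rewrite -powRrM mulVf ?gt_eqF // powRr1 // invr_ge0 ltW.
apply: gt0_ltr_powR => //; rewrite ?nnegrE ?powR_ge0 ?ltW //.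
by near: n; exact: nbhs_infty_gtr.
Unshelve. all: by end_near. Qed.

Lemma first_moment_cvg0 (R : realType) (alpha : R) (N : nat) (m : nat -> nat) :
  (forall v, (0 < v <= N)%N -> v%:R + alpha * (m v)%:R < 0) ->
  ((fun n : nat => \sum_(v < N.+1 | (0 < v)%N)
      (2 ^ 2 ^ v)%:R * (n%:R ^+ v * (n%:R `^ alpha) ^+ m v)) @ \oo --> (0 : R))%classic.
Proof.
move=> h; have E : 0 = \sum_(v < N.+1 | (0 < v)%N) (0 : R) by rewrite big1.
rewrite [X in (_ --> X)%classic]E.
apply: cvg_big => [|v v0]; first exact: add_continuous.
rewrite -[X in (_ --> X)%classic](mulr0 (2 ^ 2 ^ v)%:R).
apply: cvgMr; apply: cvg_trans (powR_natr_cvg0 (h v _)); last first.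
  by rewrite v0 -ltnS ltn_ord.
(* For [n] nonzero the powers merge into exponent [v + alpha * m v], negative by [h]. *)
apply: near_eq_cvg; near=> n.
have n0 : n%:R != 0 :> R by rewrite pnatr_eq0 -lt0n; near: n; exact: nbhs_infty_gt.
by rewrite powRD ?n0 ?implybT // powRrM !powR_mulrn ?powR_ge0 ?ler0n.
Unshelve. all: by end_near. Qed.

Theorem theorem3p6 (R : realType) (k : nat) (alpha : R)
    (hk : (1 <= k)%N) (halpha : alpha < - (k%:R)^-1) :
  almost_always (fun n => n%:R `^ alpha)
    (fun n G => forall x : reduced_homology (clique_complex G) k, x = 0).
Proof.
have k0 : 0 < k%:R :> R by rewrite ltr0n.
have alpha0 : alpha < 0 by apply: lt_trans halpha _; rewrite oppr_lt0 invr_gt0.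
have d0 : 1 + alpha * k%:R < 0.
  by move: halpha; rewrite -(ltr_pM2r k0) mulNr mulVf ?gt_eqF // -ltrBrDl sub0r.
(* Solving [N + alpha * (k * N - k * k.+1) < 0] for [N], with division by the negative
   [1 + alpha * k], gives [N > B]. *)
pose B := alpha * (k * k.+1)%:R / (1 + alpha * k%:R).
have B0 : 0 <= B by rewrite mulr_le0 ?invr_le0 ?ltW // nmulr_rlt0 // ltr0n muln_gt0 hk.
pose N := maxn k.+1 (Num.Def.archi_bound B).
have kN : (k < N)%N by rewrite leq_maxl.
have BN : B < N%:R by apply: lt_le_trans (archi_boundP B0) _; rewrite ler_nat leq_maxr.
(* These are the two density thresholds of [acyclic_sparse]: below size [N] and at size [N]. *)
pose m v := if (v < N)%N then (k * v)%N else (k * N - k * k.+1)%N.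
have mneg v : (0 < v <= N)%N -> v%:R + alpha * (m v)%:R < 0.
  rewrite /m; case: (ltnP v N) => [_|Nv] /andP[v0 vN].
    by rewrite natrM mulrA -[X in X + _]mul1r -mulrDl nmulr_rlt0 // ltr0n.
  have -> : v = N by apply/eqP; rewrite eqn_leq vN Nv.
  rewrite natrB ?leq_pmul2l // natrM mulrBr mulrA addrA -[X in X + _ - _]mul1r -mulrDl.
  by rewrite subr_lt0 mulrC -ltr_ndivrMr.
apply: (@squeeze_cvgr _ _ _ _
  (fun n => 1 - \sum_(v < N.+1 | (0 < v)%N)
      (2 ^ 2 ^ v)%:R * (n%:R ^+ v * (n%:R `^ alpha) ^+ m v)) (fun=> 1)); last 2 first.
- rewrite -[X in (_ --> X)%classic]subr0; apply: cvgB; first exact: cvg_cst.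
  exact: first_moment_cvg0.
- exact: cvg_cst.
near=> n.
have n1 : 1 <= n%:R :> R by rewrite ler1n; near: n; exact: nbhs_infty_gt.
have p1 : n%:R `^ alpha <= 1 by rewrite -[leRHS](powRr0 n%:R) ler_powR // ltW.
have p0 : 0 <= n%:R `^ alpha by exact: powR_ge0.
rewrite Gnp_prob_le1 // andbT.
apply: le_trans (@Gnp_prob_no_dense R n _ p0 p1 N m) _.
apply: Gnp_prob_mono => // G dense.
apply: homology_clique_eq0; apply: (@acyclic_sparse _ _ _ N) => // S.
  rewrite -card_gt0 => S0 SN; have := dense S; rewrite /m SN S0 (ltnW SN); exact.
move=> SN; have := dense S; rewrite /m SN ltnn leqnn (ltn_trans _ kN) // ltn_subRL addnC.
exact.
Unshelve. all: by end_near. Qed.
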